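(* Let $n>s>0$ be integers, let $X$ be an $n$-element set, and let $\mathscr{A},\mathscr{B}\subset 2^X$ be nonempty antichains that are cross $s$-union. Then the following hold. (i) $$|\mathscr{A}|+|\mathscr{B}|\le \max_{0\le i\le s/2}\left\{\binom{n}{i}+\binom{n}{s-i}\right\},$$ where $i$ ranges over integers, with equality if and only if $\{\mathscr{A},\mathscr{B}\}=\left\{\binom{X}{i^*},\binom{X}{s-i^*}\right\}$ for some integer $0\le i^*\le \frac{s}{2}$ at which the maximum on the right-hand side is attained. (ii) If, further, $n\ge 2s$, $\mathscr{A}\ne\{\emptyset\}$ and $\mathscr{B}\ne\{\emptyset\}$, then $$|\mathscr{A}|+|\mathscr{B}|\le\binom{n}{1}+\binom{n}{s-1}.$$
   Context: $2^X$ is the power set of $X$ and $\binom{X}{i}$ is the family of all $i$-element subsets of $X$. A family $\mathscr{F}\subset 2^X$ is an antichain if $F\subset F'$ never holds for distinct $F,F'\in\mathscr{F}$. Families $\mathscr{A},\mathscr{B}\subset 2^X$ are cross $s$-union if $|A\cup B|\le s$ for all $A\in\mathscr{A}$, $B\in\mathscr{B}$. *)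

(* Defs.v *)
From mathcomp Require Import all_boot.

Set Implicit Arguments.
Unset Strict Implicit.
Unset Printing Implicit Defensive.

(* The ground set X is a finite type T, so a family of subsets of X is a
   {set {set T}}. *)

Definition antichain (T : finType) (F : {set {set T}}) : Prop :=
  forall A B : {set T}, A \in F -> B \in F -> A != B -> ~~ (A \subset B).

Definition cross_union (T : finType) (s : nat) (F G : {set {set T}}) : Prop :=
  forall A B : {set T}, A \in F -> B \in G -> #|A :|: B| <= s.

Definition layer (T : finType) (i : nat) : {set {set T}} :=
  [set A : {set T} | #|A| == i].

Definition layer_pair_size (n s i : nat) : nat := 'C(n, i) + 'C(n, s - i).

(* For integers i, the condition i <= s/2 is equivalent to i <= s./2, the floor
   of s/2. *)
Definition max_layer_pair_size (n s : nat) : nat :=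
  \max_(0 <= i < s./2.+1) layer_pair_size n s i.

(* Main.v *)
Require Import Defs.
From mathcomp Require Import all_boot.
From mathcomp Require Import perm fingroup zify.

Set Implicit Arguments.
Unset Strict Implicit.
Unset Printing Implicit Defensive.

(** Fix a linear order on the [n]-element ground set. An antichain [A] contains
    at most one initial segment of the order, and [B] at most one final segment.
    If it contains an initial segment of size [i] and a final segment of size
    [j], then the cross [s]-union condition with [s < n] makes the two disjoint,
    so [i + j <= s]. Give each set of size [k] the weight ['C(n, k)]: a set of
    size [k] is initial with probability [1 / 'C(n, k)] in a random order, so
    the expected total weight of the segments that are hit is exactly
    [#|A| + #|B|] ([sum_pair_weight]). Hence a bound on the weight of every
    single order bounds [#|A| + #|B|] ([pair_card_bound]).

    For (i), one order contributes nothing, or some ['C(n, i)] with [i <= s], or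
    ['C(n, i) + 'C(n, j)] with [i + j <= s], and each is at most the maximum;
    it is strictly smaller except in the last case with [i + j = s]
    ([pair_weight_lt_or_tight]). Equality therefore forces every order to hit
    both families with complementary sizes. This says that for disjoint [S] and
    [R] with [#|S| + #|R| = s] one has [S \in A] exactly when [R \in B]
    ([saturated_matched]). Since [s < n], two [i]-sets differing in one element
    are disjoint from a common [(s - i)]-set, so membership in [A] spreads from
    one [i]-set to all of them ([matched_layers]).

    For (ii), the size [s] must be avoided, because ['C(n, s)] alone can exceed the
    bound. A member of [A] of size [s] contains every member of [B], in
    particular one fixed element [x] of a nonempty member of [B]; deleting [x]
    from the members of size [s] keeps [#|A|], the antichain property and the
    cross-union condition ([shrink_antichain]). After doing this on both sides
    all sizes are below [s], and the weight bound reduces to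
    ['C(n, i) + 'C(n, j) <= 'C(n, j.+1)] for [2 <= i <= j] and
    [2 (i + j) <= n] ([bin_pair_le_succ]). *)

(** * Binomial coefficients *)

Lemma bin_mono_half n i k : i <= k -> k.*2 <= n -> 'C(n, i) <= 'C(n, k).
Proof.
elim: k => [|k IHk]; first by rewrite leqn0 => /eqP ->.
rewrite leq_eqVlt => /orP [/eqP -> //|ltik] hk.
have le1 : 'C(n, i) <= 'C(n, k) by apply: IHk; lia.
apply: leq_trans le1 _; have := mul_bin_left n k; nia.
Qed.

Lemma bin_ltS n k : k.*2.+1 < n -> 'C(n, k) < 'C(n, k.+1).
Proof.
move=> hk; have pos : 0 < 'C(n, k) by rewrite bin_gt0; lia.
have := mul_bin_left n k; nia.
Qed.

(** Since [i < k] and [i + k < n], the index [i] is farther from [n / 2] than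
    [k] is, on whichever side [k] lies. *)
Lemma bin_lt n i k : i < k -> i + k < n -> 'C(n, i) < 'C(n, k).
Proof.
move=> ltik ltn; apply: (@leq_trans 'C(n, i.+1)); first by apply: bin_ltS; lia.
case: (leqP k.*2 n) => hk; first exact: bin_mono_half.
by rewrite -(@bin_sub n k) ?bin_mono_half //; lia.
Qed.

(** The quotient ['C(n, k) / k.+1] is nondecreasing in [k] up to [n / 2]: its
    successive ratio is [(n - k) / (k + 2)]. *)
Lemma bin_ratio n i j :
  i <= j -> j.*2 <= n -> j.+1 * 'C(n, i) <= i.+1 * 'C(n, j).
Proof.
elim: j => [|j IHj]; first by rewrite leqn0 => /eqP ->.
rewrite leq_eqVlt => /orP [/eqP -> //|ltij] hj.
have IH : j.+1 * 'C(n, i) <= i.+1 * 'C(n, j) by apply: IHj; lia.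
rewrite -(leq_pmul2l (ltn0Sn j)).
rewrite [leqRHS]mulnCA mul_bin_left.
apply: (@leq_trans ((n - j) * (j.+1 * 'C(n, i)))).
  rewrite [leqRHS]mulnCA leq_mul2l leq_mul2r.
  by apply/orP; right; apply/orP; right; lia.
by rewrite [leqRHS]mulnCA leq_mul2l IH orbT.
Qed.

(** The increment ['C(n, j.+1) - 'C(n, j)] is [(n - 2j - 1) / j.+1] times
    ['C(n, j)], where [n - 2j - 1 >= 2i - 1 >= i.+1]; by [bin_ratio] this
    absorbs ['C(n, i)]. *)
Lemma bin_pair_le_succ n i j :
  1 < i -> i <= j -> (i + j).*2 <= n -> 'C(n, i) + 'C(n, j) <= 'C(n, j.+1).
Proof.
move=> i1 leij hn; rewrite -(leq_pmul2l (ltn0Sn j)) mulnDr mul_bin_left.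
have h : j.+1 * 'C(n, i) <= i.+1 * 'C(n, j) by apply: bin_ratio; lia.
apply: leq_trans (leq_add h (leqnn _)) _.
by rewrite -mulnDl leq_mul2r; apply/orP; right; lia.
Qed.

Lemma bin_pair_le_first n s i j : 0 < s -> s.*2 <= n ->
    i < s -> j < s -> i + j <= s ->
  'C(n, i) + 'C(n, j) <= 'C(n, 1) + 'C(n, s - 1).
Proof.
wlog leij : i j / i <= j.
  by move=> W *; case: (leqP i j) => h; [|rewrite addnC]; apply: W; lia.
move=> s0 hn his hjs hij.
case: (leqP i 1) => hi.
  by apply: leq_add; apply: bin_mono_half; lia.
apply: leq_trans (leq_addl _ _).
apply: (@leq_trans 'C(n, j.+1)); first by apply: bin_pair_le_succ; lia.
by apply: bin_mono_half; lia.
Qed.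

Lemma layer_pair_le_max n s k :
  k <= s -> 'C(n, k) + 'C(n, s - k) <= max_layer_pair_size n s.
Proof.
rewrite /max_layer_pair_size big_mkord.
wlog hk : k / k <= s./2.
  move=> W ks; case: (leqP k s./2) => h; first exact: W.
  by rewrite addnC -{2}(subKn ks); apply: W; lia.
move=> ks; have hk' : k < s./2.+1 by [].
by apply: (bigmax_sup (Ordinal hk')); rewrite /layer_pair_size.
Qed.

(** The smaller index [i] can be raised to [s - j], which strictly increases
    ['C(n, i)] because [i + (s - j) < n]. *)
Lemma bin_pair_lt_max n s i j :
  s < n -> i + j < s -> 'C(n, i) + 'C(n, j) < max_layer_pair_size n s.
Proof.
wlog leij : i j / i <= j.
  by move=> W *; case: (leqP i j) => h; [|rewrite addnC]; apply: W; lia.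
move=> sn ijs; have js : j <= s by lia.
apply: leq_trans (layer_pair_le_max n js); rewrite addnC ltn_add2l.
by apply: bin_lt; lia.
Qed.

Lemma bin_lt_max n s i :
  s < n -> i <= s -> 'C(n, i) < max_layer_pair_size n s.
Proof.
move=> sn lis; apply: leq_trans (layer_pair_le_max n lis).
by rewrite -[ltnLHS]addn0 ltn_add2l bin_gt0; lia.
Qed.

(** * Initial segments of random linear orders *)

(** A permutation [p] stands for the linear order in which [x] comes before [y]
    when [p x] precedes [p y] in [enum T]. *)
Definition initial (T : finType) (p : {perm T}) (S : {set T}) :=
  [forall x, (x \in S) == (index (p x) (enum T) < #|S|)].

Section Initial.

Variable T : finType.
Implicit Types (p : {perm T}) (S U : {set T}) (F : {set {set T}}).

Lemma initialP p S :
  reflect (forall x, (x \in S) = (index (p x) (enum T) < #|S|)) (initial p S).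
Proof. by apply: (iffP forallP) => h x; [apply/eqP|rewrite h]. Qed.

Lemma initial_sub p S U :
  initial p S -> initial p U -> #|S| <= #|U| -> S \subset U.
Proof.
move=> /initialP hS /initialP hU le; apply/subsetP => x.
by rewrite hS hU => /leq_trans; apply.
Qed.

Lemma initial_inj p S U :
  initial p S -> initial p U -> #|S| = #|U| -> S = U.
Proof.
move=> hS hU e; apply/eqP; rewrite eqEcard e leqnn andbT.
by apply: initial_sub hS hU _; rewrite e.
Qed.

(** The order lists [S] first, then the rest of [U], then the complement. *)
Lemma initial_exists S U :
  S \subset U -> exists p, initial p S && initial p U.
Proof.
move=> sSU; pose l1 := enum S ++ enum (U :\: S); pose l := l1 ++ enum (~: U).
have ml1 : l1 =i U.
  move=> x; rewrite mem_cat !mem_enum !inE.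
  by case: (boolP (x \in S)) => // /(subsetP sSU) ->.
have ul1 : uniq l1.
  rewrite cat_uniq !enum_uniq /= andbT; apply/hasPn => x.
  by rewrite !mem_enum inE => /andP [].
have ul : uniq l.
  rewrite cat_uniq ul1 enum_uniq /= andbT; apply/hasPn => x.
  by rewrite mem_enum inE ml1.
have ml x : x \in l by rewrite mem_cat ml1 mem_enum inE orbN.
have sl : size l = size (enum T).
  apply/perm_size/uniq_perm => //; first exact: enum_uniq.
  by move=> x; rewrite ml mem_enum.
pose f x := nth x (enum T) (index x l).
have rf x : index (f x) (enum T) = index x l.
  by apply: index_uniq (enum_uniq _); rewrite -sl index_mem.
have injf : injective f.
  by move=> x y /(congr1 (index^~ (enum T))); rewrite !rf; apply: index_inj.
exists (perm injf); apply/andP; split; apply/initialP => x; rewrite permE rf.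
  by rewrite /l /l1 -catA index_cat mem_enum cardE; case: ifP => h;
    [rewrite index_mem mem_enum h|rewrite ltnNge leq_addr].
have <- : size l1 = #|U| by rewrite -(card_uniqP ul1); apply: eq_card.
by rewrite index_cat ml1; case: ifP => h;
  [rewrite index_mem ml1 h|rewrite ltnNge leq_addr].
Qed.

(** Composing with a permutation that carries [U] onto [S] turns orders
    starting with [S] injectively into orders starting with [U]. *)
Lemma initial_count_le S U : #|S| = #|U| ->
  #|[set p | initial p S]| <= #|[set p | initial p U]|.
Proof.
move=> e; have [q /andP [/initialP qS _]] := initial_exists (subxx S).
have [r /andP [/initialP rU _]] := initial_exists (subxx U).
rewrite -(card_imset _ (mulgI (r * q^-1)%g)).
apply/subset_leq_card/subsetP => _ /imsetP [p + ->].
rewrite !inE => /initialP pS; apply/initialP => x.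
by rewrite !permM -e -pS qS permKV rU e.
Qed.

Lemma initial_unique p k : k <= #|T| ->
  \sum_(S in layer T k) initial p S = 1.
Proof.
move=> lek.
have : 0 < #|layer T k| by rewrite card_draws bin_gt0.
case/card_gt0P => S0; rewrite inE => /eqP cS0.
have [q /andP [/initialP hq _]] := initial_exists (subxx S0).
pose S := (p * q^-1)%g @^-1: S0.
have cS : #|S| = k by rewrite card_preimset //; apply: perm_inj.
have iS : initial p S.
  by apply/initialP => x; rewrite inE permM hq permKV cS cS0.
rewrite (bigD1 S) /= ?inE ?cS // iS big1 // => U /andP [].
rewrite inE => /eqP cU neU; apply/eqP; rewrite eqb0.
by apply: contra neU => iU; apply/eqP/(initial_inj iU iS); rewrite cS.
Qed.

(** A random order starts with [S] with probability [1 / 'C(#|T|, #|S|)]: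
    all sets of one size are equally likely, and exactly one of them is
    initial. *)
Lemma initial_count S :
  'C(#|T|, #|S|) * #|[set p | initial p S]| = #|{perm T}|.
Proof.
have eqc U : U \in layer T #|S| ->
    #|[set p | initial p U]| = #|[set p | initial p S]|.
  by rewrite inE => /eqP e; apply/eqP; rewrite eqn_leq !initial_count_le.
rewrite -card_draws -sum_nat_const -(eq_bigr _ eqc).
under eq_bigr => U _ do rewrite -sum1dep_card big_mkcond.
rewrite exchange_big /= -[RHS]sum1_card; apply: eq_bigr => p _.
rewrite -[RHS](initial_unique p (max_card (mem S))); apply: eq_bigr => U _.
by case: initial.
Qed.

(** Weighting a set by the inverse of its probability of being initial makes
    the average of [weight F] over all orders equal to [#|F|]. *)
Definition weight F p := \sum_(S in F | initial p S) 'C(#|T|, #|S|).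

Lemma sum_weight F : \sum_p weight F p = #|{perm T}| * #|F|.
Proof.
rewrite mulnC -sum_nat_const (exchange_big_dep (mem F)) /= => [|p S _ /andP[] //].
apply: eq_bigr => S SF; rewrite -(initial_count S) mulnC -sum_nat_const.
by apply: eq_bigl => p; rewrite inE SF.
Qed.

(** Initial segments of one order form a chain, so an antichain contains at
    most one of them. *)
Lemma weight_antichain F p : antichain F ->
  weight F p = 0 \/
  exists S, [/\ S \in F, initial p S & weight F p = 'C(#|T|, #|S|)].
Proof.
move=> acF; case: (pickP [pred S in F | initial p S]) => [S|] /= none; last first.
  by left; apply: big_pred0.
case/andP: none => SF iS; right; exists S; split=> //.
rewrite /weight (bigD1 S) /= ?SF // big1 ?addn0 // => U /andP [/andP [UF iU] neU].
case: (leqP #|U| #|S|) => [le|/ltnW le].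
  by move: (acF U S UF SF neU); rewrite (initial_sub iU iS le).
by move: neU; rewrite eq_sym => /(acF S U SF UF); rewrite (initial_sub iS iU le).
Qed.

End Initial.

(** * Antichains and exchanges *)

Lemma set_between (T : finType) (X Y : {set T}) k :
    X \subset Y -> #|X| <= k <= #|Y| ->
  exists Z : {set T}, [/\ X \subset Z, Z \subset Y & #|Z| = k].
Proof.
move=> sXY /andP [leX leY].
have cXY : #|Y :\: X| = #|Y| - #|X| by rewrite cardsD (setIidPr sXY).
have : 0 < #|[set D : {set T} | D \subset Y :\: X & #|D| == k - #|X|]|.
  by rewrite cards_draws bin_gt0 cXY leq_sub2r.
case/card_gt0P => D; rewrite inE subsetD => /andP [/andP [sDY dDX] /eqP cD].
exists (X :|: D); split; first exact: subsetUl.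
  by rewrite subUset sXY.
by rewrite cardsU setIC disjoint_setI0 // cards0 subn0 cD subnKC.
Qed.

Lemma antichain_full_layer (T : finType) (F : {set {set T}}) k :
  antichain F -> k <= #|T| -> layer T k \subset F -> F = layer T k.
Proof.
move=> acF kT /subsetP sLF; apply/eqP; rewrite eq_sym eqEsubset.
apply/andP; split; apply/subsetP => // S SF; rewrite inE.
have SL (Z : {set T}) : #|Z| = k -> Z \in F by move=> cZ; apply: sLF; rewrite inE cZ.
apply: contraT => neS; case: (leqP #|S| k) => [leS|/ltnW geS].
  have [|Z [sSZ _ cZ]] := @set_between _ S setT k (subsetT _).
    by rewrite leS cardsT.
  have /(acF S Z SF (SL Z cZ)) : S != Z by apply: contraNneq neS => ->; rewrite cZ.
  by rewrite sSZ.
have [|Z [_ sZS cZ]] := @set_between _ set0 S k (sub0set _).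
  by rewrite cards0 geS.
have /(acF Z S (SL Z cZ) SF) : Z != S by apply: contraNneq neS => <-; rewrite cZ.
by rewrite sZS.
Qed.

(** Each exchange of an element of [S] outside the target [V] for an element of
    [V] outside [S] brings the set closer to [V]. *)
Lemma exchange_closed_layer (T : finType) (F : {set {set T}}) (S : {set T}) :
    (forall (U : {set T}) x y, U \in F -> #|U| = #|S| -> x \in U -> y \notin U ->
       y |: (U :\ x) \in F) ->
  S \in F -> layer T #|S| \subset F.
Proof.
move=> exch SF; apply/subsetP => V; rewrite inE => /eqP cV.
have [m] := ubnP #|V :\: S|; elim: m S SF cV exch => // m IHm S SF cV exch lem.
have [e|/set0Pn [y]] := eqVneq (V :\: S) set0.
  suff -> : V = S by [].
  by apply/eqP; rewrite eqEcard -setD_eq0 e eqxx cV leqnn.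
rewrite inE => /andP [yS yV].
have /set0Pn [x] : S :\: V != set0.
  rewrite setD_eq0; apply: contra yS => sSV.
  suff -> : S = V by [].
  by apply/eqP; rewrite eqEcard sSV cV leqnn.
rewrite inE => /andP [xV xS].
have cS' : #|y |: (S :\ x)| = #|S|.
  by rewrite cardsU1 !inE (negbTE yS) andbF (cardsD1 x S) xS.
apply: (IHm (y |: (S :\ x))); rewrite ?cS' //; first exact: exch.
rewrite ltnS in lem; apply: leq_trans lem; apply: proper_card.
apply/properP; split; last by exists y; rewrite !inE ?yS ?yV ?eqxx.
apply/subsetP => z; rewrite !inE negb_or negb_and negbK.
case/andP => /andP [_ /orP [/eqP ->|-> ->]] //.
by rewrite (negbTE xV).
Qed.

(** The rigidity that an extremal pair inherits from all orders at once; it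
    determines the pair as soon as one member of [A] is known. *)
Definition matched (T : finType) (s : nat) (A B : {set {set T}}) :=
  forall S R : {set T}, [disjoint S & R] -> #|S| + #|R| = s -> (S \in A) = (R \in B).

(** The sets [U] and [y |: (U :\ x)] lie in [y |: U], which has [#|S| + 1]
    elements, so [s < #|T|] leaves room for an [(s - #|S|)]-set [R] disjoint
    from both. Going from [U] to [R] and back gives closure under exchange. *)
Lemma matched_layers (T : finType) s (A B : {set {set T}}) (S : {set T}) :
    s < #|T| -> antichain A -> antichain B -> matched s A B ->
    S \in A -> #|S| <= s ->
  A = layer T #|S| /\ B = layer T (s - #|S|).
Proof.
move=> sT acA acB mAB SA leS.
have disj (U : {set T}) k : #|U| + k <= #|T| ->
    exists2 R : {set T}, [disjoint U & R] & #|R| = k.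
  move=> hk; have [|R [_ sR cR]] := @set_between _ set0 (~: U) k (sub0set _).
    by rewrite cards0 cardsCs setCK; lia.
  by exists R; rewrite // disjoint_sym disjoints_subset.
have sA : layer T #|S| \subset A.
  apply: exchange_closed_layer SA => U x y UA cU xU yU.
  have cV : #|y |: (U :\ x)| = #|U|.
    by rewrite cardsU1 !inE (negbTE yU) andbF (cardsD1 x U) xU.
  have [|R dR cR] := @disj (y |: U) (s - #|S|); first by rewrite cardsU1 yU; lia.
  have sub : y |: (U :\ x) \subset y |: U by rewrite setUS // subsetDl.
  rewrite (mAB _ R (disjointWl sub dR)) ?cV ?cU ?cR ?subnKC //.
  by rewrite -(mAB U R (disjointWl (subsetUr _ _) dR)) // cU cR subnKC.
split; first by apply: antichain_full_layer; rewrite // max_card.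
apply: antichain_full_layer => //; first by lia.
apply/subsetP => R; rewrite inE => /eqP cR.
have [|U dU cU] := @disj R #|S|; first by lia.
rewrite -(mAB U R) 1?disjoint_sym // ?cU ?cR ?subnKC //.
by apply: (subsetP sA); rewrite inE cU.
Qed.

(** * Pairs of cross [s]-union antichains *)

Section Pairs.

Variables (T : finType) (s : nat) (A B : {set {set T}}).
Hypotheses (sT : s < #|T|) (acA : antichain A) (acB : antichain B).
Hypothesis cAB : cross_union s A B.

(** A set is a final segment of an order exactly when its complement is an
    initial segment; complementing [B] lets initial segments serve for both
    families. *)
Definition pair_weight p := weight A p + weight (@setC T @: B) p.

Lemma sum_pair_weight : \sum_p pair_weight p = #|{perm T}| * (#|A| + #|B|).
Proof.
by rewrite big_split /= !sum_weight card_imset ?mulnDr //; apply: setC_inj.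
Qed.

Lemma antichain_setC : antichain (@setC T @: B).
Proof.
move=> _ _ /imsetP [S SB ->] /imsetP [R RB ->] neq; rewrite setCS.
by apply: acB => //; apply: contra neq => /eqP ->.
Qed.

(** As initial segments, [S] and [~: R] are comparable. If [~: R] were inside
    [S], then [S] and [R] would cover all of [T], against [s < #|T|]. *)
Lemma initial_pair p S R :
    S \in A -> R \in B -> initial p S -> initial p (~: R) ->
  [disjoint S & R] /\ #|S| + #|R| <= s.
Proof.
move=> SA RB iS iR.
have leSR := cAB SA RB.
have sSR : S \subset ~: R.
  case: (leqP #|S| #|~: R|) => [|/ltnW le]; first exact: initial_sub iS iR.
  have := initial_sub iR iS le; rewrite -setCS setCK => sub.
  have : S :|: R = setT by apply/eqP; rewrite -subTset -(setUCr S) setUS.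
  by move=> e; move: leSR; rewrite e cardsT leqNgt sT.
have dSR : [disjoint S & R] by rewrite disjoints_subset.
by split=> //; move: leSR; rewrite cardsU disjoint_setI0 // cards0 subn0.
Qed.

Lemma pair_weight_cases p :
  [\/ pair_weight p = 0,
      exists2 S, S \in A & pair_weight p = 'C(#|T|, #|S|),
      exists2 R, R \in B & pair_weight p = 'C(#|T|, #|R|)
    | exists S R, [/\ S \in A, R \in B, initial p S /\ initial p (~: R),
        #|S| + #|R| <= s & pair_weight p = 'C(#|T|, #|S|) + 'C(#|T|, #|R|)]].
Proof.
have binC (R : {set T}) : 'C(#|T|, #|~: R|) = 'C(#|T|, #|R|).
  by rewrite cardsCs setCK bin_sub // max_card.
rewrite /pair_weight; case: (weight_antichain p acA) => [->|[S [SA iS ->]]].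
  case: (weight_antichain p antichain_setC) => [->|[_ [/imsetP [R RB ->] _ ->]]].
    by constructor 1.
  by constructor 3; exists R; rewrite ?binC.
case: (weight_antichain p antichain_setC) => [->|[_ [/imsetP [R RB ->] iR ->]]].
  by constructor 2; exists S; rewrite ?addn0.
constructor 4; exists S, R; split=> //; last by rewrite binC.
by have [] := initial_pair SA RB iS iR.
Qed.

(** The average of [pair_weight] over all orders is [#|A| + #|B|], so if the
    average reaches the upper bound then so does every term. *)
Lemma pair_card_bound M :
    (forall p, pair_weight p <= M) ->
  #|A| + #|B| <= M /\ (#|A| + #|B| = M -> forall p, pair_weight p = M).
Proof.
move=> le.
have [le_sum eq_sum] := leqif_sum (P := predT) (fun p _ => leqif_eq (le p)).
have N0 : 0 < #|{perm T}| by apply/card_gt0P; exists 1%g.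
move: le_sum eq_sum; rewrite sum_pair_weight sum_nat_const.
rewrite leq_pmul2l // eqn_pmul2l // => leM eqM; split=> // /eqP e p.
by move: eqM; rewrite e => /esym /forallP /(_ p) /eqP.
Qed.

End Pairs.

(** * The upper bound and its equality case *)

Lemma cross_unionC (T : finType) s (A B : {set {set T}}) :
  cross_union s A B -> cross_union s B A.
Proof. by move=> cAB S R SB RA; rewrite setUC; apply: cAB. Qed.

Lemma cross_union_card (T : finType) s (A B : {set {set T}}) (S : {set T}) :
  cross_union s A B -> B != set0 -> S \in A -> #|S| <= s.
Proof.
move=> cAB /set0Pn [R RB] SA.
exact: leq_trans (subset_leq_card (subsetUl S R)) (cAB S R SA RB).
Qed.

(** Strictness in every case other than [#|S| + #|R| = s] is what makes the
    equality characterization possible. When only one family is hit, by a set of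
    size [i <= s], the bound is strict since ['C(n, s - i)] is positive. *)
Lemma pair_weight_lt_or_tight (T : finType) s (A B : {set {set T}}) p :
    s < #|T| -> A != set0 -> B != set0 -> antichain A -> antichain B ->
    cross_union s A B ->
    pair_weight A B p < max_layer_pair_size #|T| s \/
  pair_weight A B p <= max_layer_pair_size #|T| s /\
  exists S R, [/\ S \in A, R \in B, initial p S /\ initial p (~: R)
    & #|S| + #|R| = s].
Proof.
move=> sT A0 B0 acA acB cAB.
case: (pair_weight_cases sT acA acB cAB p).
- move=> ->; left; apply: leq_ltn_trans (bin_lt_max sT (leq0n s)); exact: leq0n.
- by move=> [S SA ->]; left; apply/bin_lt_max/(cross_union_card cAB).
- move=> [R RB ->]; left; apply/bin_lt_max => //.
  exact: (cross_union_card (cross_unionC cAB)).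
move=> [S [R [SA RB iSR]]]; rewrite leq_eqVlt => /orP [/eqP e|lt] ->.
  right; split; last by exists S, R.
  by have := @layer_pair_le_max #|T| s #|S|; rewrite -{2}e addKn; apply; lia.
by left; apply: bin_pair_lt_max.
Qed.

(** Take an order that starts with [S] and ends with [R]. The sets of [A] and
    [B] that it hits have sizes adding up to [s]; if one of them is [S] or [R],
    then the other has the size of, hence equals, the remaining one. *)
Lemma saturated_matched (T : finType) s (A B : {set {set T}}) :
    antichain A -> antichain B ->
    (forall p : {perm T}, exists S R, [/\ S \in A, R \in B,
       initial p S /\ initial p (~: R) & #|S| + #|R| = s]) ->
  matched s A B.
Proof.
move=> acA acB sat S R dSR cSR.
have sSR : S \subset ~: R by rewrite -disjoints_subset.
have [p /andP [iS iR]] := initial_exists sSR.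
have [U [V [UA VB [iU iV] cUV]]] := sat p.
have comp (X Y : {set T}) :
    initial p X -> initial p Y -> X \subset Y \/ Y \subset X.
  move=> iX iY; case: (leqP #|X| #|Y|) => [|/ltnW] h.
    by left; apply: initial_sub iX iY h.
  by right; apply: initial_sub iY iX h.
have anti (F : {set {set T}}) (X Y : {set T}) :
    antichain F -> X \in F -> Y \in F -> X \subset Y \/ Y \subset X -> X = Y.
  move=> acF XF YF [] sub; apply/eqP; apply: contraT => ne.
    by move: (acF X Y XF YF ne); rewrite sub.
  by rewrite eq_sym in ne; move: (acF Y X YF XF ne); rewrite sub.
apply/idP/idP => [SA|RB].
  have e : S = U by apply: anti acA SA UA _; apply: comp.
  have -> // : R = V.
  apply/setC_inj/(initial_inj iR iV); rewrite [LHS]cardsCs [RHS]cardsCs !setCK.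
  by rewrite -e in cUV; lia.
have e : R = V.
  apply: anti acB RB VB _.
  by have := comp _ _ iR iV; rewrite !setCS => -[]; [right|left].
have -> // : S = U by apply: (initial_inj iS iU); rewrite -e in cUV; lia.
Qed.

(** * Removing the sets of size [s] *)

(** Deletion of [x] from the sets of size [s], the only size for which the
    weight bound of (ii) can fail. *)
Definition shrink (T : finType) s (x : T) (S : {set T}) :=
  if #|S| == s then S :\ x else S.

Lemma shrink_sub (T : finType) s (x : T) (S : {set T}) : shrink s x S \subset S.
Proof. by rewrite /shrink; case: ifP; rewrite ?subsetDl. Qed.

(** If [S :\ x] is contained in a member [U] with fewer than [s] elements, then
    the sizes force [S :\ x = U], so [U] is contained in [S]; for two shrunk
    sets, [x] can be put back. Hence inclusions between images come only from
    equal sets, which gives both injectivity and the antichain property. *)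
Lemma shrink_antichain (T : finType) s x (A : {set {set T}}) :
    0 < s -> antichain A -> (forall S : {set T}, S \in A -> #|S| <= s) ->
    (forall S : {set T}, S \in A -> #|S| = s -> x \in S) ->
  [/\ #|shrink s x @: A| = #|A|, antichain (shrink s x @: A)
    & forall S : {set T}, S \in shrink s x @: A -> #|S| < s].
Proof.
move=> s0 acA leA xA.
have eqA (S U : {set T}) : S \in A -> U \in A -> S \subset U -> S = U.
  by move=> SA UA; apply: contraTeq; apply: acA.
have refl (S U : {set T}) : S \in A -> U \in A ->
    shrink s x S \subset shrink s x U -> S = U.
  move=> SA UA; rewrite {1}/shrink; case: eqP => [cS|_] sub; last first.
    exact: eqA (subset_trans sub (shrink_sub s x U)).
  have xS := xA S SA cS; move: sub; rewrite /shrink; case: eqP => [cU|cU] sub.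
    apply: eqA => //; rewrite -(setD1K xS) -(setD1K (xA U UA cU)).
    exact: setUS.
  apply/esym; apply: eqA => //; have <- : S :\ x = U; last exact: subsetDl.
  apply/eqP; rewrite eqEcard sub.
  by have := leA U UA; have := cardsD1 x S; rewrite xS; lia.
split.
- by apply: card_in_imset => S U SA UA e; apply: refl => //; rewrite e.
- move=> _ _ /imsetP [S SA ->] /imsetP [U UA ->].
  by apply: contra => sub; rewrite (refl S U SA UA sub).
- move=> _ /imsetP [S SA ->]; have := leA S SA; have := cardsD1 x S.
  by rewrite /shrink; case: eqP => [cS|] //; [rewrite xA //|]; lia.
Qed.

Lemma nonempty_member (T : finType) (B : {set {set T}}) :
  B != set0 -> B != [set set0] -> exists R x, R \in B /\ x \in R.
Proof.
move=> B0 B1; have : ~~ (B \subset [set set0]) by rewrite subset1 negb_or B0 B1.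
by case/subsetPn => R RB; rewrite inE => /set0Pn [x xR]; exists R, x.
Qed.

(** A member of [A] of size [s] has no room to grow, so it contains every
    member of [B]. *)
Lemma full_member (T : finType) s (A B : {set {set T}}) (R : {set T}) x :
    cross_union s A B -> R \in B -> x \in R ->
  forall S : {set T}, S \in A -> #|S| = s -> x \in S.
Proof.
move=> cAB RB xR S SA cS; suff -> : S = S :|: R by rewrite inE xR orbT.
by apply/eqP; rewrite eqEcard subsetUl cS cAB.
Qed.

Lemma small_pair_card (T : finType) s (A B : {set {set T}}) :
    0 < s -> s.*2 <= #|T| -> antichain A -> antichain B -> cross_union s A B ->
    (forall S : {set T}, S \in A -> #|S| < s) ->
    (forall S : {set T}, S \in B -> #|S| < s) ->
  #|A| + #|B| <= 'C(#|T|, 1) + 'C(#|T|, s - 1).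
Proof.
move=> s0 hn acA acB cAB sA sB; have sT : s < #|T| by lia.
have single i : i < s -> 'C(#|T|, i) <= 'C(#|T|, 1) + 'C(#|T|, s - 1).
  by move=> si; apply: leq_trans (leq_addl _ _); apply: bin_mono_half; lia.
apply: (proj1 (pair_card_bound _)) => p.
case: (pair_weight_cases sT acA acB cAB p) => [->//|[S SA ->]|[R RB ->]|].
- exact/single/sA.
- exact/single/sB.
move=> [S [R [SA RB _ le ->]]].
by apply: bin_pair_le_first; auto.
Qed.

(** * Both parts together *)

Lemma eq_set2 (I : finType) (a b c d : I) :
  [set a; b] = [set c; d] -> a = c /\ b = d \/ a = d /\ b = c.
Proof.
move=> e.
have /set2P ac : a \in [set c; d] by rewrite -e set21.
have /set2P bc : b \in [set c; d] by rewrite -e set22.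
have /set2P ca : c \in [set a; b] by rewrite e set21.
have /set2P da : d \in [set a; b] by rewrite e set22.
by case: ac bc ca da => [->|->] [->|->]; intuition.
Qed.

Theorem corollary1p3 (n s : nat) (hs : 0 < s) (hsn : s < n)
    (T : finType) (hT : #|T| = n) (A B : {set {set T}})
    (hA0 : A != set0) (hB0 : B != set0)
    (hA : antichain A) (hB : antichain B) (hAB : cross_union s A B) :
  (#|A| + #|B| <= max_layer_pair_size n s /\
   (#|A| + #|B| = max_layer_pair_size n s <->
    exists i : nat,
      [/\ i <= s./2,
          layer_pair_size n s i = max_layer_pair_size n s
        & [set A; B] = [set layer T i; layer T (s - i)]]))
  /\
  (2 * s <= n -> A != [set set0] -> B != [set set0] ->
   #|A| + #|B| <= 'C(n, 1) + 'C(n, s - 1)).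
Proof.
subst n; have hBA := cross_unionC hAB.
have max_p p := pair_weight_lt_or_tight p hsn hA0 hB0 hA hB hAB.
split; last first.
  move=> hn A1 B1.
  have [R [x [RB xR]]] := nonempty_member hB0 B1.
  have [S [y [SA yS]]] := nonempty_member hA0 A1.
  have leA (U : {set T}) : U \in A -> #|U| <= s by exact: cross_union_card hAB hB0.
  have leB (U : {set T}) : U \in B -> #|U| <= s by exact: cross_union_card hBA hA0.
  have [<- acA' ltA'] := shrink_antichain hs hA leA (full_member hAB RB xR).
  have [<- acB' ltB'] := shrink_antichain hs hB leB (full_member hBA SA yS).
  apply: small_pair_card => //; first by rewrite -mul2n.
  move=> _ _ /imsetP [U UA ->] /imsetP [V VB ->].
  apply: leq_trans (hAB U V UA VB); apply: subset_leq_card.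
  by apply: setUSS; apply: shrink_sub.
have le_p p : pair_weight A B p <= max_layer_pair_size #|T| s.
  by case: (max_p p) => [/ltnW|[]].
have [leM eqM] := pair_card_bound le_p; split=> //; split; last first.
  case=> i [_ <- /eq_set2 [] [-> ->]]; rewrite !card_draws /layer_pair_size //.
  by rewrite addnC.
move=> /[dup] cardM /eqM sat.
have mAB : matched s A B.
  apply: saturated_matched => // p; case: (max_p p) => [|[_ //]].
  by rewrite sat ltnn.
have /set0Pn [S SA] := hA0; have leS := cross_union_card hAB hB0 SA.
have [eA eB] := matched_layers hsn hA hB mAB SA leS.
have sizes : 'C(#|T|, #|S|) + 'C(#|T|, s - #|S|) = max_layer_pair_size #|T| s.
  by rewrite -cardM eA eB !card_draws.
case: (leqP #|S| s./2) => hS.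
  by exists #|S|; rewrite eA eB.
exists (s - #|S|); rewrite /layer_pair_size subKn //; split; first by lia.
  by rewrite addnC.
by rewrite eA eB setUC.
Qed.
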